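(* \begin{equation*} \Gamma_{i}^{\left[\substack{s\\ s+1}\right]\times i} = \begin{cases} 2^{2s+2i-1} - 3\cdot 2^{3i-4} + 2^{2i-3} & \text{if } 1\leq i\leq s+1,\\ 2^{2s+2i-2} - 3\cdot 2^{3i-4} + 2^{4i-2s-6} & \text{if } s+2\leq i\leq 2s+1. \end{cases} \end{equation*}
   Context: $\Gamma_{i}^{\left[\substack{s\\ s+1}\right]\times k}$ denotes the number of rank $i$ matrices over $\mathbb{F}_2$ of the form $\left[\frac{A}{B}\right]$ where $A$ is an $s\times k$ persymmetric matrix and $B$ an $(s+1)\times k$ persymmetric matrix over $\mathbb{F}_2$; here $k=i$.
   Formalization: In the second case (s+2 ≤ i ≤ 2s+1) the leading term is 2^{2s+2i-1} instead of the printed 2^{2s+2i-2}; the printed formula is false (for s=1, i=3 it gives −16, while the count is 48). *)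

(* Defs.v *)
From mathcomp Require Export all_boot all_order all_algebra.

Set Implicit Arguments.
Unset Strict Implicit.
Unset Printing Implicit Defensive.

Import GRing.Theory.

(* "Persymmetric" is meant for rectangular matrices, in the Hankel sense:
   entries are constant along each antidiagonal (i + j constant). *)
Definition persymmetric (m n : nat) (A : 'M['F_2]_(m, n)) : bool :=
  [forall i1 : 'I_m, forall j1 : 'I_n, forall i2 : 'I_m, forall j2 : 'I_n,
     (i1 + j1 == i2 + j2)%N ==> (A i1 j1 == A i2 j2)].

Definition Gamma (s t k i : nat) : nat :=
  #|[set M : 'M['F_2]_(s + t, k) |
       [&& persymmetric (usubmx M), persymmetric (dsubmx M) & \rank M == i]]|.

(* Main.v *)
(** A Hankel matrix with [n] rows and [k] columns over F_2 is a linear functional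
    [b] on the polynomials of size at most [L = n + k - 1]: a polynomial [v] of
    size at most [k] is in its kernel iff [b] vanishes on [v X^j] for all
    [j + k <= L].  Let [r] be least such that some [f <> 0] of size at most [r + 1]
    is such an annihilator, and [R = L + 1 - r >= r].  Comparing the ranks of the
    two Hankel matrices of [b] with [k] and with [L + 1 - k] columns shows that the
    kernel with [k] columns is [f S_(k-r)] for [k <= R] and
    [f S_(k-r) (+) g S_(k-R)] for [R <= k <= L + 1], with [S_m] the polynomials of
    size at most [m].  The first moment of the kernel size gives the number
    [4^(k-1)] of [b] with [r < k].

    To count the pairs [(a, b)] without common annihilator, fix [b]: then [a] has to
    be injective on the kernel of [b], and the number of such [a] depends only on
    [r].  For at most [s + 2] columns the sum over [b] is again a first moment.
    Replacing [(t, k, r)] by [(t+2, k+2, r+2)] multiplies the number of [b] by 16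
    and the number of [a] by 4, so together with the symmetry in [a] and [b] the
    count for [(s, s+1, k)] is 64 times the one for [(s-1, s, k-2)]. *)
Require Import Defs.
From mathcomp Require Import all_boot all_order all_algebra.
From mathcomp Require Import zify ring.

Set Implicit Arguments.
Unset Strict Implicit.
Unset Printing Implicit Defensive.

Import GRing.Theory.
Local Open Scope ring_scope.

Notation F := 'F_2.

(** * Cardinalities over F_2 *)

Lemma card_rVF n : #|{: 'rV[F]_n}| = (2 ^ n)%N.
Proof. by rewrite card_mx card_Fp // mul1n. Qed.

(** All fibres of a surjective additive map are cosets of its kernel; the proportion is multiplied
    out to avoid division. *)
Lemma card_preim_surj (U V : finZmodType) (h : U -> V) (P : pred V) :
  (forall x y, h (x + y) = h x + h y) -> (forall y, exists x, h x = y) ->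
  (#|[set x | P (h x)]| * #|V| = #|[set y | P y]| * #|U|)%N.
Proof.
move=> hD hs.
have fib y : #|[set x | h x == y]| = #|[set x | h x == 0%R]|.
  have [x0 hx0] := hs y.
  have h0 : h 0 = 0 by apply: (addrI (h 0)); rewrite -hD !addr0.
  have hN x : h (- x) = - h x by apply: (addrI (h x)); rewrite -hD !subrr.
  rewrite -[RHS](card_imset _ (addrI x0)); apply: eq_card => x; rewrite !inE.
  apply/idP/imsetP => [/eqP hx | [z]].
    exists (x - x0); last by rewrite addrC subrK.
    by rewrite inE hD hN hx hx0 subrr.
  by rewrite inE => /eqP hz ->; rewrite hD hz addr0 hx0.
have main (Q : pred V) :
    #|[set x | Q (h x)]| = (#|[set y | Q y]| * #|[set x | h x == 0%R]|)%N.
  rewrite -sum1_card (partition_big h Q) /=; last by move=> x; rewrite inE.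
  rewrite -sum_nat_const; apply: eq_big => [y|y Qy]; first by rewrite inE.
  rewrite -(fib y) -sum1_card; apply: eq_bigl => x; rewrite !inE.
  by case: eqP => [->|]; rewrite ?Qy ?andbT ?andbF.
have -> : #|U| = (#|V| * #|[set x | h x == 0%R]|)%N.
  rewrite -[LHS]cardsT -[#|V|]cardsT -(main predT).
  by apply: eq_card => x; rewrite !inE.
by rewrite main; lia.
Qed.

(** * Functionals on polynomials and their annihilators *)

Definition ev L (b : 'rV[F]_L) (p : {poly F}) : F := \sum_(i < L) b 0 i * p`_i.

Lemma evD L (b : 'rV_L) p q : ev b (p + q) = ev b p + ev b q.
Proof. by rewrite -big_split; apply: eq_bigr => i _; rewrite coefD mulrDr. Qed.

Lemma evZ L (b : 'rV_L) c p : ev b (c *: p) = c * ev b p.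
Proof. by rewrite mulr_sumr; apply: eq_bigr => i _; rewrite coefZ mulrCA. Qed.

Lemma ev0 L (b : 'rV_L) : ev b 0 = 0.
Proof. by rewrite -(scale0r 0) evZ mul0r. Qed.

Lemma ev_sum L (b : 'rV_L) (I : finType) (p : I -> {poly F}) :
  ev b (\sum_i p i) = \sum_i ev b (p i).
Proof. by apply: (big_morph _ (evD b) (ev0 b)). Qed.

Lemma evDl L (b b' : 'rV_L) p : ev (b + b') p = ev b p + ev b' p.
Proof. by rewrite -big_split; apply: eq_bigr => i _; rewrite mxE mulrDl. Qed.

Lemma evXn L (b : 'rV_L) (i : 'I_L) : ev b 'X^i = b 0 i.
Proof.
rewrite /ev (bigD1 i) //= coefXn eqxx mulr1 big1 ?addr0 // => j ji.
by rewrite coefXn (inj_eq val_inj) (negPf ji) mulr0.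
Qed.

Lemma sum_scale_Xn n (v : 'rV[F]_n) : \sum_i v 0 i *: 'X^i = rVpoly v.
Proof.
rewrite [in RHS](row_sum_delta v) linear_sum; apply: eq_bigr => i _.
by rewrite linearZ /= rVpoly_delta.
Qed.

Lemma rVpoly_inj n : injective (@rVpoly F n).
Proof. exact: can_inj (@rVpolyK F n). Qed.

Lemma size_rVpoly n (v : 'rV[F]_n) : (size (rVpoly v) <= n)%N.
Proof. exact: size_poly. Qed.


(** * Prescribing a functional on independent polynomials *)

Section Transfer.
Variables (M m : nat) (q : 'I_m -> {poly F}).
Hypothesis sq : forall i, (size (q i) <= M)%N.
Hypothesis q_free : forall v : 'rV[F]_m, \sum_i v 0 i *: q i = 0 -> v = 0.

Let A : 'M[F]_(m, M) := \matrix_i poly_rV (q i).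

Let A_free : row_free A.
Proof.
rewrite -kermx_eq0; apply/rowV0P => v /sub_kermxP vA; apply: q_free.
have sz : (size (\sum_i v 0%R i *: q i)%R <= M)%N.
  apply: (leq_trans (size_sum _ _ _)); apply/bigmax_leqP => i _.
  exact: leq_trans (size_scale_leq _ _) (sq i).
rewrite -(poly_rV_K sz).
suff -> : poly_rV (\sum_i v 0 i *: q i) = 0 :> 'rV_M by rewrite linear0.
rewrite linear_sum -[RHS]vA mulmx_sum_row; apply: eq_bigr => i _.
by rewrite linearZ /= rowK.
Qed.

Lemma restrict_dim : (m <= M)%N.
Proof. by move: A_free => /eqP <-; apply: rank_leq_col. Qed.

(** Independence of the [q i] makes evaluation at them surjective, with fibres of [2 ^ (M - m)]
    functionals. *)
Lemma card_restrict (P : pred 'rV[F]_m) :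
  #|[set a : 'rV_M | P (\row_i ev a (q i))]|
  = (2 ^ (M - m) * #|[set a | P a]|)%N.
Proof.
have mM := restrict_dim.
have := @card_preim_surj 'rV[F]_M 'rV[F]_m (fun a => \row_i ev a (q i)) P.
rewrite !card_rVF => E; apply/eqP; rewrite -(eqn_pmul2r (expn_gt0 2 m)) E.
- by rewrite mulnAC -expnD subnK // mulnC.
- by move=> x y; apply/rowP => i; rewrite !mxE evDl.

have /row_freeP[B AB] := A_free.
(* The transpose of a right inverse of [A] yields a functional with the prescribed values [y]. *)
move=> y; exists (y *m B^T).
have /rowP yE : (y *m B^T) *m A^T = y by rewrite -mulmxA -trmx_mul AB trmx1 mulmx1.
apply/rowP => i; rewrite mxE -[RHS]yE [RHS]mxE.
by apply: eq_bigr => j _; rewrite !mxE.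
Qed.
End Transfer.

(* [k] is part of the data, as for a binary form of degree [k - 1]: a polynomial
   of size smaller than [k] has fewer conditions to satisfy for larger [k]. *)
Definition annih L (b : 'rV[F]_L) k (p : {poly F}) :=
  (size p <= k)%N && [forall j : 'I_(L.+1 - k), ev b (p * 'X^j) == 0].

Lemma annihP L (b : 'rV[F]_L) k (p : {poly F}) :
  reflect ((size p <= k)%N /\ forall j, (j + k <= L)%N -> ev b (p * 'X^j) = 0)
          (annih b k p).
Proof.
apply: (iffP andP) => [[-> /forallP H]|[-> H]]; split=> //.
  move=> j jk; have lt : (j < L.+1 - k)%N by lia.
  exact/eqP/(H (Ordinal lt)).
by apply/forallP => j; apply/eqP/H; have := ltn_ord j; lia.
Qed.

(** * Annihilators of one functional and the first generator *)

Section Annih.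
Variables (L : nat) (b : 'rV[F]_L).

Lemma annih0 k : annih b k 0.
Proof. by apply/annihP; split=> [|j _]; rewrite ?size_poly0 ?mul0r ?ev0. Qed.

Lemma annihD k p q : annih b k p -> annih b k q -> annih b k (p + q).
Proof.
move=> /annihP[sp hp] /annihP[sq hq]; apply/annihP; split=> [|j jk].
  by apply: leq_trans (size_polyD _ _) _; rewrite geq_max sp.
by rewrite mulrDl evD hp // hq // addr0.
Qed.

Lemma annihZ k c p : annih b k p -> annih b k (c *: p).
Proof.
move=> /annihP[sp hp]; apply/annihP; split=> [|j jk].
  exact: leq_trans (size_scale_leq _ _) sp.
by rewrite -scalerAl evZ hp // mulr0.
Qed.

Lemma annihN k p : annih b k p -> annih b k (- p).
Proof. by rewrite -scaleN1r; apply: annihZ. Qed.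

Lemma annih_widen k k' p : (k <= k')%N -> annih b k p -> annih b k' p.
Proof.
move=> kk' /annihP[sp hp]; apply/annihP; split=> [|j jk]; first lia.
by apply: hp; lia.
Qed.

Lemma annihMXn k n p : annih b k p -> annih b (k + n) (p * 'X^n).
Proof.
move=> /annihP[sp hp]; apply/annihP; split=> [|j jk].
  by apply: leq_trans (size_polyMleq _ _) _; rewrite size_polyXn; lia.
by rewrite -mulrA -exprD hp //; lia.
Qed.

(** Bounds are degrees plus one, so [r.+1] and [n] combine to [r + n]. *)
Lemma annihM r n (f w : {poly F}) :
  annih b r.+1 f -> (size w <= n)%N -> annih b (r + n) (f * w).
Proof.
move=> hf sw; rewrite -(poly_rV_K sw) -sum_scale_Xn mulr_sumr.
apply: (big_ind (annih b (r + n))) => [|p q|i _]; [exact: annih0|exact: annihD|].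
rewrite -scalerAr; apply: annihZ.
have := annihMXn i hf; apply: annih_widen; have := ltn_ord i; lia.
Qed.

Lemma annih_full (p : {poly F}) : (size p <= L.+1)%N -> annih b L.+1 p.
Proof. by move=> sp; apply/annihP; split=> // j; lia. Qed.

Definition annih_set k : {set 'rV[F]_k} := [set v | annih b k (rVpoly v)].

(* The Hankel matrices with [k] and with [L + 1 - k] columns are transposed. *)
Lemma card_annih_dual k : (k <= L.+1)%N ->
  (#|annih_set k| * 2 ^ (L.+1 - k) = #|annih_set (L.+1 - k)| * 2 ^ k)%N.
Proof.
have ker m n (A : 'M[F]_(m, n)) : #|[set v : 'rV_m | v *m A == 0%R]| = (2 ^ (m - \rank A))%N.
  rewrite -mxrank_ker -card_rVF.
  rewrite -(card_imset _ (row_free_inj (m := 1) (row_base_free (kermx A)))).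
  apply: eq_card => v; rewrite inE; apply/idP/imsetP.
    move/eqP/sub_kermxP; rewrite -(eq_row_base (kermx A)) => /submxP[w ->].
    by exists w.
  move=> [w _ ->]; apply/eqP/sub_kermxP; rewrite -(eq_row_base (kermx A)).
  exact: submxMl.
pose hk m n : 'M[F]_(m, n) := \matrix_(i, j) ev b 'X^(i + j).
(* The annihilators form the left kernel of the [m] by [n] Hankel matrix. *)
have cE m n : (m + n = L.+1)%N -> #|annih_set m| = (2 ^ (m - \rank (hk m n)))%N.
  move=> mn; rewrite -ker; apply: eq_card => v; rewrite !inE.
  have E j : ev b (rVpoly v * 'X^j) = \sum_i v 0 i * ev b 'X^(i + j).
    rewrite -sum_scale_Xn mulr_suml ev_sum; apply: eq_bigr => i _.
    by rewrite -scalerAl evZ -exprD.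
  apply/annihP/eqP => [[_ H]|H].
    apply/rowP => j; rewrite !mxE -[RHS](H j); last by have := ltn_ord j; lia.
    by rewrite E; apply: eq_bigr => i _; rewrite mxE.
  split=> [|j jm]; first exact: size_rVpoly.
  have lt : (j < n)%N by lia.
  move/rowP/(_ (Ordinal lt)): H; rewrite !mxE => H0; rewrite E -[RHS]H0.
  by apply: eq_bigr => i _; rewrite mxE.
move=> kL; have tr : (hk k (L.+1 - k)%N)^T = hk (L.+1 - k)%N k.
  by apply/matrixP => i j; rewrite !mxE addnC.
rewrite (cE k (L.+1 - k)%N) ?(cE (L.+1 - k)%N k); try lia.
rewrite -tr mxrank_tr -!expnD; congr (2 ^ _)%N.
have := rank_leq_row (hk k (L.+1 - k)%N).
by have := rank_leq_col (hk k (L.+1 - k)%N); lia.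
Qed.

Lemma annih_set_eq1 k : (forall p, annih b k p -> p = 0) -> #|annih_set k| = 1%N.
Proof.
move=> H; apply/(@etrans _ _ #|[set (0 : 'rV[F]_k)]|); last exact: cards1.
apply: eq_card => v; rewrite !inE.
apply/idP/eqP => [/H|->]; last by rewrite linear0 annih0.
by rewrite -(linear0 (@rVpoly F k)) => /rVpoly_inj.
Qed.

(** For the bound [L.+1] there is no condition left, so any nonzero vector is a witness. *)
Lemma nonzero_annih_ex : exists m, [exists v : 'rV_m.+1, (v != 0) && annih b m.+1 (rVpoly v)].
Proof.
exists L; apply/existsP; exists (const_mx 1); apply/andP; split; last first.
  exact/annih_full/size_rVpoly.
by apply/eqP => /rowP /(_ 0); rewrite !mxE.
Qed.

Definition rk : nat := ex_minn nonzero_annih_ex.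

Lemma rk_leL : (rk <= L)%N.
Proof.
rewrite /rk; case: ex_minnP => m _; apply; apply/existsP; exists (const_mx 1).
apply/andP; split; last exact/annih_full/size_rVpoly.
by apply/eqP => /rowP /(_ 0); rewrite !mxE.
Qed.

Lemma rk_min k p : (k <= rk)%N -> annih b k p -> p = 0.
Proof.
move=> kr hp; have [//|p0] := eqVneq p 0.
have /annihP[sp _] := hp.
case: k kr hp sp => [|k] kr hp sp.
  by apply/eqP; rewrite -size_poly_eq0 -leqn0.
move: kr; rewrite /rk; case: ex_minnP => m _ /(_ k) H km.
suff : (m <= k)%N by lia.
apply: H; apply/existsP; exists (poly_rV p); rewrite poly_rV_K // hp andbT.
apply: contraNneq p0 => E; by rewrite -(poly_rV_K sp) E linear0.
Qed.

Lemma rk_gen : exists2 f : {poly F}, f != 0 & annih b rk.+1 f.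
Proof.
rewrite /rk; case: ex_minnP => m /existsP[v /andP[v0 hv]] _.
exists (rVpoly v) => //; apply: contraNneq v0 => E.
by apply/eqP/rVpoly_inj; rewrite E linear0.
Qed.

(** By duality at [rk], where only zero annihilates, [2 ^ (L.+1 - rk)] is a positive multiple of
    [2 ^ rk]. *)
Lemma double_rk : (rk.*2 <= L.+1)%N.
Proof.
have rL := rk_leL.
have := @card_annih_dual rk (leq_trans rL (leqnSn L)).
rewrite annih_set_eq1; last by move=> p; apply: rk_min.
rewrite mul1n => E.
have : (2 ^ rk <= 2 ^ (L.+1 - rk))%N.
  rewrite E leq_pmull //; apply/card_gt0P; exists 0.
  by rewrite inE linear0 annih0.
by rewrite leq_exp2l //; lia.
Qed.

(** At the bound [R = L.+1 - rk], duality with the trivial kernel at [rk] leaves exactly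
    [2 ^ (R - rk)] annihilators, as many as there are multiples [f * w]. Smaller bounds are reduced
    to this one. *)
Lemma annih_gen1 (f : {poly F}) : f != 0 -> annih b rk.+1 f -> forall k p,
  (k <= L.+1 - rk)%N ->
  reflect (exists2 w : {poly F}, (size w <= k - rk)%N & p = f * w) (annih b k p).
Proof.
move=> f0 hf.
have dr := double_rk.
pose R := (L.+1 - rk)%N.
have sMf (w : {poly F}) : (size w <= R - rk)%N -> annih b R (f * w).
  move=> sw; have := annihM hf sw; apply: annih_widen; lia.
have top p : annih b R p -> exists2 w : {poly F}, (size w <= R - rk)%N & p = f * w.
  pose h (w : 'rV[F]_(R - rk)) : 'rV[F]_R := poly_rV (f * rVpoly w).
  have hK w : rVpoly (h w) = f * rVpoly w.
    by rewrite poly_rV_K //; have /annihP[] := sMf _ (size_rVpoly w).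
  have hinj : injective h.
    move=> u v /(congr1 rVpoly); rewrite !hK => /(mulfI f0).
    exact: rVpoly_inj.
  have hE : h @: setT = annih_set R.
    apply/eqP; rewrite eqEcard; apply/andP; split.
      by apply/subsetP => _ /imsetP[w _ ->]; rewrite inE hK sMf ?size_rVpoly.
    rewrite card_imset // cardsT card_rVF.
    have := @card_annih_dual rk; rewrite annih_set_eq1; last by move=> ?; apply: rk_min.
    rewrite mul1n -/R => E; rewrite -(leq_pmul2r (expn_gt0 2 rk)) -E; last lia.
    by rewrite -expnD leq_exp2l //; rewrite /R; lia.
  move=> hp; have /annihP[sp _] := hp.
  have : poly_rV p \in annih_set R by rewrite inE poly_rV_K.
  rewrite -hE => /imsetP[w _ /(congr1 rVpoly)]; rewrite hK poly_rV_K // => ->.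
  by exists (rVpoly w) => //; apply: size_rVpoly.
(* Apply the top case to both [p] and [p X^(R-k)]. *)
move=> k p kR; apply: (iffP idP) => [hp|[w sw ->]].
  have [w sw pE] := top p (annih_widen kR hp).
  exists w => //.
  have := annihMXn (R - k) hp; rewrite subnKC // => /top[w' sw' E'].
  have E : w' = w * 'X^(R - k).
    by apply: (mulfI f0); rewrite -E' pE mulrA.
  have [->|w0] := eqVneq w 0; first by rewrite size_poly0.
  by move: sw'; rewrite E size_mulXn //; lia.
have [->|w0] := eqVneq w 0; first by rewrite mulr0 annih0.
have := annihM hf sw; apply: annih_widen.
have : size w != 0%N by rewrite size_poly_eq0.
lia.
Qed.

End Annih.

(** * The second generator of the annihilators *)

Section TwoGenerators.
Variables (L : nat) (b : 'rV[F]_L) (f : {poly F}).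
Hypotheses (f0 : f != 0) (hf : annih b (rk b).+1 f).

Let r := rk b.
Let R := (L.+1 - r)%N.

Let rR : (r <= R)%N.
Proof. by have := double_rk b; rewrite /R /r; lia. Qed.

Lemma card_annih_large k : (R <= k <= L.+1)%N ->
  #|annih_set b k| = (2 ^ (k - r + (k - R)))%N.
Proof.
have rL := rk_leL b => /andP[Rk kL]; have := @card_annih_dual L b k kL.
rewrite [X in (_ = X * _)%N -> _]annih_set_eq1; last first.
  by move=> p; apply: rk_min; rewrite /R /r in Rk; lia.
move=> E; apply/eqP; rewrite -(eqn_pmul2r (expn_gt0 2 (L.+1 - k))) E mul1n.
by rewrite -expnD; apply/eqP; congr (2 ^ _)%N; move: Rk; rewrite /R /r; lia.
Qed.

(** At the bound [R.+1] the kernel has dimension one more than the space of the [w], so the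
    multiples of [f] cannot fill it. The hypothesis [0 < r] keeps [R.+1] within [L.+1]. *)
Lemma second_generator : (0 < r)%N -> exists2 g : {poly F}, annih b R.+1 g &
  forall w : {poly F}, (size w <= R.+1 - r)%N -> g <> f * w.
Proof.
move=> r0; have rL := rk_leL b.
pose h (w : 'rV[F]_(R.+1 - r)) : 'rV[F]_R.+1 := poly_rV (f * rVpoly w).
have /subsetPn[v] : ~~ (annih_set b R.+1 \subset h @: setT).
  apply: contraT; rewrite negbK => /subset_leq_card.
  rewrite card_annih_large; last by rewrite leqnSn /R; lia.
  move/leq_trans/(_ (leq_imset_card _ _)); rewrite cardsT card_rVF leq_exp2l //.
  by lia.
rewrite inE => hv nv; exists (rVpoly v) => // w sw E; case/negP: nv.
apply/imsetP; exists (poly_rV w); rewrite ?inE // /h poly_rV_K // -E.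
by rewrite rVpolyK.
Qed.

(** Induction on [n]: constant coefficients are split off, the rest is divided by [X], and what
    remains is absorbed into a multiple of [f]. *)
Lemma generators_free (g : {poly F}) : annih b R.+1 g ->
  (forall w : {poly F}, (size w <= R.+1 - r)%N -> g <> f * w) ->
  forall n (w u : {poly F}), (R + n <= L.+1)%N -> (size w <= R + n - r)%N ->
  (size u <= n)%N -> f * w + g * u = 0 -> w = 0 /\ u = 0.
Proof.
move=> hg ng; have rL := rk_leL b.
elim=> [|n IHn] w u RnL sw su E.
  have u0 : u = 0 by apply/eqP; rewrite -size_poly_eq0 -leqn0.
  move/eqP: E; rewrite u0 mulr0 addr0 mulf_eq0 (negPf f0) /= => /eqP.
  by [].
have [w0 [w1 [wE sw0 sw1]]] : exists w0 w1 : {poly F},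
    [/\ w = w0 + w1 * 'X, (size w0 <= 1)%N & (size w1 <= R + n - r)%N].
  exists (take_poly 1 w), (drop_poly 1 w); rewrite size_drop_poly size_take_poly.
  by rewrite -['X]expr1 poly_take_drop; split=> //; lia.
have [u0 [u1 [uE su0 su1]]] : exists u0 u1 : {poly F},
    [/\ u = u0 + u1 * 'X, (size u0 <= 1)%N & (size u1 <= n)%N].
  exists (take_poly 1 u), (drop_poly 1 u); rewrite size_drop_poly size_take_poly.
  by rewrite -['X]expr1 poly_take_drop; split=> //; lia.
(* [q] annihilates [b] for the bound [R + n], and [q X] for [R + 1]; hence [q] does
   so for [R], and is a multiple of [f]. *)
pose q := f * w1 + g * u1.
have qX : q * 'X = - (f * w0 + g * u0).
  apply/eqP; rewrite -addr_eq0 -E wE uE /q; apply/eqP.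
  by ring.
have hq : annih b (R + n) q.
  apply: annihD; last exact: annihM hg su1.
  by have := annihM hf sw1; apply: annih_widen; rewrite -/r; lia.
have hqX : annih b R.+1 (q * 'X).
  rewrite qX; apply/annihN/annihD; last by have := annihM hg su0; rewrite addn1.
  have := annihM hf sw0; apply: annih_widen; rewrite -/r; lia.
have {}hq : annih b R q.
  have /annihP[_ hq0] := hq; have /annihP[sqX hq1] := hqX.
  apply/annihP; split=> [|[|j] jR].
  - have [->|nq] := eqVneq q 0; first by rewrite size_poly0.
    by move: sqX; rewrite size_mulX.
  - by apply: hq0; lia.
  - by rewrite exprS mulrA; apply: hq1; lia.
have /(annih_gen1 f0 hf _ (leqnn _))[z sz qE] := hq.
(* Since [q = f * z], the smaller relation is [f * (w1 - z) + g * u1 = 0]. *)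
have [] := IHn (w1 - z) u1 _ _ su1 _; first lia.
- apply: leq_trans (size_polyD _ _) _; rewrite size_polyN geq_max sw1 /=.
  by apply: leq_trans sz _; rewrite -/r; lia.
- by rewrite mulrBr addrAC -/q qE subrr.
move=> /eqP; rewrite subr_eq0 => /eqP w1z u10.
have uC : u = (u`_0)%:P by apply: size1_polyC; rewrite uE u10 mul0r addr0.
have [c0|c0] := eqVneq u`_0 0.
  have u0' : u = 0 by rewrite uC c0.
  move/eqP: E; rewrite u0' mulr0 addr0 mulf_eq0 (negPf f0) /= => /eqP.
  by [].
(* Now [u] is a nonzero constant, and dividing by it would make [g] a multiple of [f]. *)
case: (ng (- (u`_0)^-1 *: w)).
  apply: leq_trans (size_scale_leq _ _) _; rewrite wE w1z.
  apply: leq_trans (size_polyD _ _) _; rewrite geq_max.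
  have [->|nz] := eqVneq z 0; first by rewrite mul0r size_poly0; lia.
  by rewrite size_mulX //; move: sz; rewrite -/r -/R; lia.
apply: (@scalerI _ _ (u`_0)); rewrite // -scalerAr scalerA mulrN divff // scaleN1r.
by apply/eqP; rewrite -addr_eq0 -mul_polyC -uC addrC [u * g]mulrC E.
Qed.

(** Freeness makes [(w, u) |-> f * w + g * u] injective, and [card_annih_large] shows that its image
    is already the whole kernel. *)
Lemma annih_gen2 : exists g : {poly F}, forall k, (R <= k <= L.+1)%N ->
  (forall w u : {poly F}, (size w <= k - r)%N -> (size u <= k - R)%N ->
     annih b k (f * w + g * u)) /\
  (forall w u : {poly F}, (size w <= k - r)%N -> (size u <= k - R)%N ->
     f * w + g * u = 0 -> w = 0 /\ u = 0) /\
  (forall p, annih b k p -> exists w u : {poly F},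
     [/\ (size w <= k - r)%N, (size u <= k - R)%N & p = f * w + g * u]).
Proof.
have rL := rk_leL b.
have [r0|r0] := posnP r.
  (* Here [R = L.+1], hence [k = R] and [u] is forced to be zero, so [g] may be taken to be zero. *)
  exists 0 => k /andP[Rk kL].
  have kR : k = R by rewrite /R r0 subn0 in Rk *; lia.
  rewrite kR subnn; split; [|split].
  - move=> w u sw _; rewrite mul0r addr0; apply/(annih_gen1 f0 hf) => //.
    by exists w.
  - move=> w u _; rewrite size_poly_leq0 => /eqP ->.
    by rewrite mul0r addr0 => /eqP; rewrite mulf_eq0 (negPf f0) => /eqP.
  - move=> p /(annih_gen1 f0 hf _ (leqnn _))[w sw ->].
    by exists w, 0; rewrite mul0r addr0 size_poly0.
have [g hg ng] := second_generator r0.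
exists g => k /andP[Rk kL].
have mem (w u : {poly F}) : (size w <= k - r)%N -> (size u <= k - R)%N ->
    annih b k (f * w + g * u).
  move=> sw su; apply: annihD.
    by have := annihM hf sw; rewrite -/r subnKC //; lia.
  by have := annihM hg su; rewrite subnKC.
have inj (w u : {poly F}) : (size w <= k - r)%N -> (size u <= k - R)%N ->
     f * w + g * u = 0 -> w = 0 /\ u = 0.
  by move=> sw su; apply: (generators_free hg ng (n := (k - R)%N)); rewrite ?subnKC.
split=> //; split=> //.
pose h (v : 'rV[F]_(k - r) * 'rV[F]_(k - R)) : 'rV[F]_k :=
  poly_rV (f * rVpoly v.1 + g * rVpoly v.2).
have hK v : rVpoly (h v) = f * rVpoly v.1 + g * rVpoly v.2.
  rewrite poly_rV_K //.
  by have /annihP[] := mem _ _ (size_rVpoly v.1) (size_rVpoly v.2).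
have hinj : injective h.
  move=> [w u] [w' u'] /(congr1 rVpoly); rewrite !hK /= => /eqP.
  rewrite -subr_eq0 opprD addrACA -!mulrBr -!linearB => /eqP.
  case/inj; rewrite ?size_rVpoly // -?(linear0 rVpoly).
  move=> /(congr1 (fun p => poly_rV p : 'rV_(k - r))) +
         /(congr1 (fun p => poly_rV p : 'rV_(k - R))).
  rewrite !rVpolyK !linear0 => /eqP + /eqP.
  by rewrite !subr_eq0 => /eqP -> /eqP ->.
have hE : h @: setT = annih_set b k.
  apply/eqP; rewrite eqEcard; apply/andP; split.
    by apply/subsetP => _ /imsetP[w _ ->]; rewrite inE hK mem ?size_rVpoly.
  by rewrite card_imset // cardsT card_prod !card_rVF card_annih_large ?Rk // expnD.
move=> p hp; have /annihP[sp _] := hp.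
have : poly_rV p \in annih_set b k by rewrite inE poly_rV_K.
rewrite -hE => /imsetP[v _ /(congr1 rVpoly)]; rewrite hK poly_rV_K // => ->.
by exists (rVpoly v.1), (rVpoly v.2); rewrite !size_rVpoly.
Qed.

End TwoGenerators.

(** * Counting functionals *)

Definition restr M (a : 'rV[F]_M) (f : {poly F}) m : 'rV[F]_m :=
  \row_j ev a (f * 'X^j).

Lemma ev_restr M (a : 'rV_M) f m (w : {poly F}) : (size w <= m)%N ->
  ev (restr a f m) w = ev a (f * w).
Proof.
move=> sw; rewrite -{2}(poly_rV_K sw) -sum_scale_Xn mulr_sumr ev_sum.
by apply: eq_bigr => i _; rewrite !mxE -scalerAr evZ mulrC.
Qed.

Section Restrict2.
Variables (M m1 m2 : nat) (f g : {poly F}).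
Hypothesis sf : forall j, (j < m1)%N -> (size (f * 'X^j)%R <= M)%N.
Hypothesis sg : forall j, (j < m2)%N -> (size (g * 'X^j)%R <= M)%N.
Hypothesis fg_free : forall w u : {poly F}, (size w <= m1)%N -> (size u <= m2)%N ->
  f * w + g * u = 0 -> w = 0 /\ u = 0.

Let q (i : 'I_(m1 + m2)) : {poly F} :=
  match split i with inl j => f * 'X^j | inr j => g * 'X^j end.

Let ql j : q (lshift m2 j) = f * 'X^j.
Proof. by rewrite /q -[lshift m2 j]/(unsplit (inl j)) unsplitK. Qed.

Let qr j : q (rshift m1 j) = g * 'X^j.
Proof. by rewrite /q -[rshift m1 j]/(unsplit (inr j)) unsplitK. Qed.

Let sq i : (size (q i) <= M)%N.
Proof. by rewrite /q; case: (split i) => j; [apply: sf|apply: sg]. Qed.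

Let q_free (v : 'rV[F]_(m1 + m2)) : \sum_i v 0 i *: q i = 0 -> v = 0.
Proof.
rewrite big_split_ord /=.
under eq_bigr => i _ do rewrite ql scalerAr.
under [X in _ + X]eq_bigr => i _ do rewrite qr scalerAr.
rewrite -!mulr_sumr => E.
have El : \sum_(i < m1) v 0 (lshift m2 i) *: 'X^i = rVpoly (lsubmx v).
  by rewrite -sum_scale_Xn; apply: eq_bigr => i _; rewrite mxE.
have Er : \sum_(i < m2) v 0 (rshift m1 i) *: 'X^i = rVpoly (rsubmx v).
  by rewrite -sum_scale_Xn; apply: eq_bigr => i _; rewrite mxE.
rewrite El Er in E.
have [/(congr1 (fun p => poly_rV p : 'rV_m1)) vl /(congr1 (fun p => poly_rV p : 'rV_m2)) vr] :=
  fg_free (size_rVpoly _) (size_rVpoly _) E.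
by rewrite -[v]hsubmxK; move: vl vr; rewrite !rVpolyK !linear0 => -> ->; rewrite row_mx0.
Qed.

(** The [f * 'X^j] and [g * 'X^j] are jointly independent, so every pair of restrictions arises from
    equally many [a]. *)
Lemma card_restrict2 (P : 'rV[F]_m1 -> 'rV[F]_m2 -> bool) :
  #|[set a : 'rV_M | P (restr a f m1) (restr a g m2)]|
  = (2 ^ (M - (m1 + m2)) * #|[set a : 'rV_m1 * 'rV_m2 | P a.1 a.2]|)%N.
Proof.
have := card_restrict sq q_free (fun v => P (lsubmx v) (rsubmx v)).
have -> : #|[set a | P (lsubmx a) (rsubmx a)]| = #|[set a : 'rV_m1 * 'rV_m2 | P a.1 a.2]|.
  rewrite -(card_imset _ (can_inj (g := fun v => (lsubmx v, rsubmx v))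
    (f := fun a : 'rV[F]_m1 * 'rV[F]_m2 => row_mx a.1 a.2) _)) /=.
    apply: eq_card => v; rewrite inE; apply/idP/imsetP => [Pv|[a]].
      by exists (lsubmx v, rsubmx v); rewrite ?inE //= hsubmxK.
    by rewrite inE => Pa ->; rewrite row_mxKl row_mxKr.
  by move=> [x y] /=; rewrite row_mxKl row_mxKr.
move=> <-; apply: eq_card => a; rewrite !inE; congr (P _ _).
  by apply/rowP => j; rewrite !mxE ql.
by apply/rowP => j; rewrite !mxE qr.
Qed.

End Restrict2.

Lemma size_mulXn_leq (p : {poly F}) k j : (size p <= k)%N -> (size (p * 'X^j)%R <= k + j)%N.
Proof.
by move=> sp; apply: leq_trans (size_polyMleq _ _) _; rewrite size_polyXn; lia.
Qed.

(** Annihilation by [p] amounts to [L - k] independent linear conditions on [b], one for each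
    [p * 'X^j]. *)
Lemma card_functionals_killed L k (p : {poly F}) : (k <= L)%N ->
  p != 0 -> (size p <= k.+1)%N ->
  #|[set b : 'rV_L | annih b k.+1 p]| = (2 ^ k)%N.
Proof.
move=> kL p0 sp; pose m := (L - k)%N.
have E (b : 'rV[F]_L) : annih b k.+1 p = (restr b p m == 0).
  apply/annihP/eqP => [[_ H]|H].
    apply/rowP => j; have jm : (j < L - k)%N := ltn_ord j.
    by rewrite !mxE H //; lia.
  split=> // j jk; have lt : (j < m)%N by rewrite /m; lia.
  by move/rowP/(_ (Ordinal lt)): H; rewrite !mxE.
under eq_finset => b do rewrite E.
rewrite (@card_restrict L m (fun j => p * 'X^j) _ _ (pred1 0)).
- have -> : (L - m = k)%N by rewrite /m; lia.
  have -> : #|[set a | pred1 (0 : 'rV[F]_m) a]| = #|[set (0 : 'rV[F]_m)]|.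
    by apply: eq_card => a; rewrite !inE.
  by rewrite cards1 muln1.
- move=> i; apply: leq_trans (size_mulXn_leq _ sp) _.
  by have im : (i < L - k)%N := ltn_ord i; lia.
move=> v; under eq_bigr => i _ do rewrite scalerAr.
rewrite -mulr_sumr sum_scale_Xn => /eqP; rewrite mulf_eq0 (negPf p0) /= => /eqP.
by move=> E0; apply: rVpoly_inj; rewrite E0 linear0.
Qed.

(** Double counting of the pairs of [b] and annihilator: zero occurs for all [2 ^ L] functionals,
    each other polynomial for [2 ^ k]. *)
Lemma sum_card_annih L k : (k <= L)%N ->
  (\sum_(b : 'rV[F]_L) #|annih_set b k.+1| + 2 ^ k = 2 ^ L + 2 ^ (2 * k).+1)%N.
Proof.
move=> kL.
under eq_bigr => b _ do rewrite -sum1_card big_mkcond /=.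
rewrite exchange_big /= (bigD1 0) //=.
have -> : (\sum_(b : 'rV[F]_L)
    (if (0%R : 'rV[F]_k.+1) \in annih_set b k.+1 then 1 else 0) = 2 ^ L)%N.
  rewrite -card_rVF -sum1_card; apply: eq_bigr => b _.
  by rewrite inE linear0 annih0.
rewrite (eq_bigr (fun=> 2 ^ k)%N); last first.
  move=> v v0; rewrite -big_mkcond /= sum1dep_card.
  rewrite -(@card_functionals_killed L k (rVpoly v)) ?size_rVpoly //.
    by apply: eq_card => b; rewrite !inE.
  by apply: contraNneq v0 => E; apply/eqP/rVpoly_inj; rewrite E linear0.
rewrite sum_nat_const -addnA -[X in (_ + (_ + X))%N]mul1n -mulnDl; congr (_ + _)%N.
have -> : (#|[pred v : 'rV[F]_k.+1 | v != 0%R]| + 1 = 2 ^ k.+1)%N.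
  have -> : #|[pred v : 'rV[F]_k.+1 | v != 0%R]| = #|predC1 (0%R : 'rV[F]_k.+1)|.
    by apply: eq_card => v; rewrite !inE.
  by rewrite cardC1 card_rVF addn1 prednK ?expn_gt0.
by rewrite -expnD; congr (2 ^ _)%N; lia.
Qed.

Lemma card_annih_small L (b : 'rV[F]_L) k : (k <= L.+1 - rk b)%N ->
  #|annih_set b k| = (2 ^ (k - rk b))%N.
Proof.
move=> kR; have [f f0 hf] := rk_gen b.
pose h (w : 'rV[F]_(k - rk b)) : 'rV[F]_k := poly_rV (f * rVpoly w).
have mem (w : 'rV[F]_(k - rk b)) : annih b k (f * rVpoly w).
  by apply/(annih_gen1 f0 hf _ kR); exists (rVpoly w); rewrite ?size_rVpoly.
have hK w : rVpoly (h w) = f * rVpoly w.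
  by rewrite poly_rV_K //; have /annihP[] := mem w.
have hinj : injective h.
  move=> u v /(congr1 rVpoly); rewrite !hK => /(mulfI f0).
  exact: rVpoly_inj.
rewrite -card_rVF -(card_imset _ hinj); apply: eq_card => v; rewrite inE.
apply/idP/imsetP => [/(annih_gen1 f0 hf _ kR)[w sw vE]|[w _ ->]].
  by exists (poly_rV w) => //; rewrite /h poly_rV_K // -vE rVpolyK.
by rewrite hK.
Qed.

(* The indicator of [rk b < j + 1] is [|K_(j+1)| - 2 |K_j| + 1], with [K_k] the
   annihilators of size at most [k]; so the count follows from [sum_card_annih]. *)
Lemma card_rk_lt L j : (2 * j <= L)%N ->
  #|[set b : 'rV[F]_L | rk b < j.+1]%N| = (2 ^ (2 * j))%N.
Proof.
move=> jL.
have E (b : 'rV[F]_L) : (#|annih_set b j.+1| + 1 = 2 * #|annih_set b j| + (rk b < j.+1))%N.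
  have d := double_rk b.
  rewrite !card_annih_small; try lia.
  case: ltnP => rj; last first.
    by have [-> ->] : (j.+1 - rk b = 0 /\ j - rk b = 0)%N by lia.
  by rewrite subSn // expnS.
have S : (\sum_(b : 'rV[F]_L) #|annih_set b j.+1| + 2 ^ L =
    2 * \sum_(b : 'rV[F]_L) #|annih_set b j| + #|[set b : 'rV[F]_L | rk b < j.+1]%N|)%N.
  rewrite -sum1_card [X in (_ = _ + X)%N]big_mkcond /= big_distrr /= -big_split /=.
  rewrite -{1}card_rVF -sum1_card -big_split /=; apply: eq_bigr => b _.
  by rewrite E inE; case: (rk b < _)%N.
have := @sum_card_annih L j.
have m2 : (2 * \sum_(b : 'rV[F]_L) #|annih_set b j| + 2 ^ j = 2 * 2 ^ L + 2 ^ (2 * j))%N.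
  case: j jL {E S} => [|j] jL.
    rewrite (eq_bigr (fun=> 1%N)); last first.
      by move=> b _; apply: annih_set_eq1 => p; apply: rk_min.
    by rewrite sum1_card card_rVF.
  have := @sum_card_annih L j; rewrite (_ : 2 * j.+1 = (2 * j).+2)%N; last lia.
  by rewrite !expnS; lia.
rewrite expnS; lia.
Qed.

Lemma card_rk_lt_all L j : (L.+1 < 2 * j)%N ->
  #|[set b : 'rV[F]_L | rk b < j]%N| = (2 ^ L)%N.
Proof.
move=> jL; rewrite -card_rVF -cardsT; apply: eq_card => b; rewrite !inE.
by have := double_rk b; lia.
Qed.

(** * Pairs of functionals without common annihilator *)

Definition no_common L1 L2 k (a : 'rV[F]_L1) (b : 'rV[F]_L2) :=
  [forall v : 'rV_k, annih a k (rVpoly v) && annih b k (rVpoly v) ==> (v == 0)].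

Lemma no_commonP L1 L2 k (a : 'rV[F]_L1) (b : 'rV[F]_L2) :
  reflect (forall p, annih a k p -> annih b k p -> p = 0) (no_common k a b).
Proof.
apply: (iffP forallP) => [H p ap bp|H v].
  have /annihP[sp _] := ap; have := H (poly_rV p).
  rewrite poly_rV_K // ap bp /= => /eqP E.
  by rewrite -(poly_rV_K sp) E linear0.
apply/implyP => /andP[/H{}H /H E]; apply/eqP/rVpoly_inj.
by rewrite E linear0.
Qed.

Definition complements S k L (b : 'rV[F]_L) :=
  #|[set a : 'rV[F]_(S + k - 1) | no_common k a b]|.

(** Injectivity of [a] on [f S_c (+) g S_d], expressed through the restrictions of [a] along [f] and
    [g]. The generators themselves have disappeared, which is why the count depends only on
    sizes. *)
Definition indep2 S c d m1 m2 (a1 : 'rV[F]_m1) (a2 : 'rV[F]_m2) :=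
  [forall w : 'rV_c, forall u : 'rV_d,
    [forall j : 'I_S, ev a1 (rVpoly w * 'X^j) + ev a2 (rVpoly u * 'X^j) == 0]
      ==> (w == 0) && (u == 0)].

Lemma indep2P S c d m1 m2 (a1 : 'rV[F]_m1) (a2 : 'rV[F]_m2) :
  reflect (forall w u : {poly F}, (size w <= c)%N -> (size u <= d)%N ->
             (forall j, (j < S)%N -> ev a1 (w * 'X^j) + ev a2 (u * 'X^j) = 0) ->
             w = 0 /\ u = 0)
          (indep2 S c d a1 a2).
Proof.
apply: (iffP forallP) => [H w u sw su E|H w].
  have /forallP/(_ (poly_rV u)) := H (poly_rV w); rewrite !poly_rV_K //.
  move/implyP => {}H.
  have /andP[/eqP w0 /eqP u0] :
      (poly_rV w == 0 :> 'rV_c) && (poly_rV u == 0 :> 'rV_d).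
    by apply: H; apply/forallP => j; rewrite E.
  by rewrite -(poly_rV_K sw) -(poly_rV_K su) w0 u0 !linear0.
apply/forallP => u; apply/implyP => /forallP E.
have [] := H _ _ (size_rVpoly w) (size_rVpoly u).
  by move=> j jS; apply/eqP/(E (Ordinal jS)).
move=> w0 u0; apply/andP; split; apply/eqP/rVpoly_inj; rewrite linear0 //.
Qed.

Definition indep_pairs S c d m1 m2 :=
  #|[set a : 'rV[F]_m1 * 'rV[F]_m2 | indep2 S c d a.1 a.2]|.

(** Whether [a] is injective on the kernel of [b] depends only on its two restrictions, which are
    equidistributed by [card_restrict2]. The guards on [c] and [d] allow length 0 for a missing
    summand. *)
Lemma complements_gen S k L (b : 'rV[F]_L) (f g : {poly F}) c d m1 m2 :
  (0 < k)%N ->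
  ((0 < c)%N -> (c + S <= m1.+1)%N) -> ((0 < d)%N -> (d + S <= m2.+1)%N) ->
  (forall j, (j < m1)%N -> (size (f * 'X^j)%R <= S + k - 1)%N) ->
  (forall j, (j < m2)%N -> (size (g * 'X^j)%R <= S + k - 1)%N) ->
  (forall w u : {poly F}, (size w <= m1)%N -> (size u <= m2)%N ->
    f * w + g * u = 0 -> w = 0 /\ u = 0) ->
  (forall w u : {poly F}, (size w <= c)%N -> (size u <= d)%N ->
    f * w + g * u = 0 -> w = 0 /\ u = 0) ->
  (forall w u : {poly F}, (size w <= c)%N -> (size u <= d)%N ->
    annih b k (f * w + g * u)) ->
  (forall p, annih b k p -> exists w u : {poly F},
    [/\ (size w <= c)%N, (size u <= d)%N & p = f * w + g * u]) ->
  complements S k b = (2 ^ (S + k - 1 - (m1 + m2)) * indep_pairs S c d m1 m2)%N.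
Proof.
move=> k0 hc hd sf sg free free' mem gen.
rewrite /complements /indep_pairs -(card_restrict2 sf sg free).
apply: eq_card => a; rewrite !inE.
have small (c' m : nat) (w : {poly F}) j : ((0 < c')%N -> (c' + S <= m.+1)%N) ->
    (size w <= c')%N -> (j < S)%N -> (size (w * 'X^j)%R <= m)%N.
  move=> h sw jS; have [->|w0] := eqVneq w 0; first by rewrite mul0r size_poly0.
  have : size w != 0%N by rewrite size_poly_eq0.
  by rewrite size_mulXn //; lia.
have E (w u : {poly F}) j : (size w <= c)%N -> (size u <= d)%N -> (j < S)%N ->
    ev (restr a f m1) (w * 'X^j) + ev (restr a g m2) (u * 'X^j)
    = ev a ((f * w + g * u) * 'X^j).
  move=> sw su jS; rewrite !ev_restr ?(small _ _ _ _ hc sw jS) ?(small _ _ _ _ hd su jS) //.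
  by rewrite mulrDl evD !mulrA.
apply/no_commonP/indep2P => [H w u sw su Z|H p ap].
  apply: free' => //; apply: H; last exact: mem.
  apply/annihP; split=> [|j jk]; first by have /annihP[] := mem w u sw su.
  by rewrite -E ?Z //; lia.
move=> /gen[w [u [sw su pE]]].
have [] := H w u sw su; last by rewrite pE => -> ->; rewrite !mulr0 addr0.
by move=> j jS; rewrite E // -pE; have /annihP[_] := ap; apply; lia.
Qed.

(* The products of polynomials of sizes at most [c] and [S] span the polynomials of
   size at most [gdim S c], when [S > 0]. *)
Definition gdim S c := if c is c'.+1 then (S + c')%N else 0%N.

(* With [r = rk b], the kernel of [b] is [f S_(k-r) (+) g S_(r-t)], where the
   truncated subtractions make the missing summands trivial. *)
Definition weight S t k r :=
  (2 ^ (S + k - 1 - (gdim S (k - r) + gdim S (r - t))) *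
   indep_pairs S (k - r) (r - t) (gdim S (k - r)) (gdim S (r - t)))%N.

Lemma weight_top S t k r : (k <= r)%N -> (r <= t)%N ->
  weight S t k r = (2 ^ (S + k - 1 - (0 + 0)) * indep_pairs S 0 0 0 0)%N.
Proof.
by rewrite /weight -!subn_eq0 => /eqP -> /eqP ->.
Qed.

Lemma weight_one S t k r : (r <= t)%N -> weight S t k r =
  (2 ^ (S + k - 1 - (gdim S (k - r) + 0)) * indep_pairs S (k - r) 0 (gdim S (k - r)) 0)%N.
Proof. by rewrite /weight -!subn_eq0 => /eqP ->. Qed.

Lemma complementsE S t k (b : 'rV[F]_(t + k - 1)) : (0 < k)%N -> (S <= t.+1)%N ->
  complements S k b = weight S t k (rk b).
Proof.
move=> k0 St; have dr := double_rk b; have rL := rk_leL b.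
have gdimP c : (0 < c)%N -> (c + S <= (gdim S c).+1)%N by case: c => //= c _; lia.
have gdimE c : (0 < c)%N -> gdim S c = (S + c - 1)%N by case: c => //= c _; lia.
have [f f0 hf] := rk_gen b; have /annihP[sf _] := hf.
have [kr|rk_k] := leqP k (rk b).
  rewrite weight_top; [|lia|lia].
  apply: (@complements_gen S k _ b 0 0 0 0 0 0) => //.
  - by move=> w u; rewrite !size_poly_leq0 => /eqP -> /eqP ->.
  - by move=> w u; rewrite !size_poly_leq0 => /eqP -> /eqP ->.
  - by move=> w u _ _; rewrite !mul0r addr0 annih0.
  - move=> p /(rk_min kr) ->; exists 0, 0; by rewrite size_poly0 !mul0r addr0.
have fM (w : {poly F}) : f * w = 0 -> w = 0.
  by move/eqP; rewrite mulf_eq0 (negPf f0) => /eqP.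
have sfX j : (j < gdim S (k - rk b))%N -> (size (f * 'X^j)%R <= S + k - 1)%N.
  rewrite gdimE; last lia.
  by move=> jm; apply: leq_trans (size_mulXn_leq _ sf) _; lia.
have [rt|tr] := leqP (rk b) t.
  have kR : (k <= (t + k - 1).+1 - rk b)%N by lia.
  rewrite weight_one //.
  apply: (@complements_gen S k _ b f 0) => //; first exact: gdimP.
  - by move=> w u _; rewrite size_poly_leq0 => /eqP ->; rewrite mul0r addr0 => /fM.
  - by move=> w u _; rewrite size_poly_leq0 => /eqP ->; rewrite mul0r addr0 => /fM.
  - move=> w u sw _; rewrite mul0r addr0; apply/(annih_gen1 f0 hf _ kR).
    by exists w.
  - move=> p /(annih_gen1 f0 hf _ kR)[w sw ->]; exists w, 0.
    by rewrite size_poly0 mul0r addr0.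
have [g gP] := annih_gen2 f0 hf.
have [] := gP k; first by apply/andP; split; lia.
have -> : (k - ((t + k - 1).+1 - rk b) = rk b - t)%N by lia.
move=> mem [free' gen].
(* Freeness for the longer restrictions comes from the same generators at the bound [S + k - 1],
   which [S <= t.+1] keeps within range. *)
have [] := gP (S + k - 1)%N; first by apply/andP; split; lia.
have -> : (S + k - 1 - ((t + k - 1).+1 - rk b) = gdim S (rk b - t))%N by rewrite gdimE; lia.
have -> : (S + k - 1 - rk b = gdim S (k - rk b))%N by rewrite gdimE; lia.
move=> memM [free _].
apply: (@complements_gen S k _ b f g); rewrite //; try exact: gdimP.
move=> j jm; have := memM 0 'X^j; rewrite size_poly0 size_polyXn => /(_ isT jm).
by rewrite mulr0 add0r => /annihP[].
Qed.

(** The kernel of [b] contains [f S_c] with [c = k - rk b > S]. By [double_rk] the restriction [a']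
    has rank below [c], so some nonzero [f * w] is a common annihilator. *)
Lemma complements_eq0 S k L (b : 'rV[F]_L) : (rk b + S < k)%N -> complements S k b = 0%N.
Proof.
move=> rSk; apply/eqP; rewrite cards_eq0; apply/eqP/setP => a; rewrite !inE.
apply/negP => /no_commonP H.
have [f f0 hf] := rk_gen b.
pose c := (k - rk b)%N; pose a' := restr a f (S + c - 1).
have [w w0 hw] := rk_gen a'.
have d := double_rk a'.
have {}hw : annih a' c w by move: hw; apply: annih_widen; rewrite /c in d *; lia.
have /annihP[sw hw'] := hw.
have bfw : annih b k (f * w).
  by have := annihM hf sw; rewrite /c subnKC //; lia.
have /annihP[sfw _] := bfw.
have /eqP : f * w = 0.
  apply: H => //; apply/annihP; split=> // j jk.
  rewrite -mulrA -(@ev_restr _ a f (S + c - 1)%N); first by apply: hw'; rewrite /c; lia.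
  by apply: leq_trans (size_mulXn_leq _ sw) _; rewrite /c; lia.
by rewrite mulf_eq0 (negPf f0) (negPf w0).
Qed.

(** With [d = 0] the condition says that the single functional has rank at least [c]; the complement
    is counted by [card_rk_lt]. *)
Lemma indep_pairs1 S c : (0 < c <= S.+1)%N ->
  (indep_pairs S c 0 (gdim S c) 0 + 2 ^ (2 * c.-1) = 2 ^ (S + c.-1))%N.
Proof.
case: c => //= c cS.
have -> : indep_pairs S c.+1 0 (S + c) 0 = #|[set a : 'rV[F]_(S + c) | c < rk a]%N|.
  rewrite -(card_imset _ (can_inj (g := fst)
    (f := fun a : 'rV[F]_(S + c) => (a, 0 : 'rV[F]_0)) _)) //.
  apply: eq_card => -[a z]; rewrite inE /= (thinmx0 z).
  have -> : ((a, 0) \in [set (x, 0 : 'rV[F]_0) |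
      x in [set x : 'rV[F]_(S + c) | (c < rk x)%N]]) = (c < rk a)%N.
    apply/imsetP/idP => [[x]|ca]; first by rewrite inE => + [->].
    by exists a; rewrite ?inE.
  apply/indep2P/idP => [H|ca w u sw].
    rewrite ltnNge; apply/negP => ac; have [f f0 hf] := rk_gen a.
    have /annihP[sf hf'] : annih a c.+1 f by move: hf; apply: annih_widen.
    have [] := H f 0 sf; rewrite ?size_poly0 //; last by move/eqP: f0.
    by move=> j jS; rewrite mul0r ev0 addr0 hf' //; lia.
  rewrite size_poly_leq0 => /eqP -> H; split=> //.
  apply: (rk_min ca); apply/annihP; split=> // j jS.
  by have := H j; rewrite mul0r ev0 addr0; apply; lia.
rewrite -(@card_rk_lt (S + c)%N c); last lia.
rewrite -card_rVF -cardsT -(cardsID [set a | c < rk a]%N setT); congr (_ + _)%N.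
  by apply: eq_card => a; rewrite !inE.
by apply: eq_card => a; rewrite !inE andbT -leqNgt ltnS.
Qed.

(** * Counting pairs and the shift by two columns *)

Definition pairs_count S t k :=
  #|[set ab : 'rV[F]_(S + k - 1) * 'rV[F]_(t + k - 1) | no_common k ab.1 ab.2]|.

Lemma pairs_countC S t k : pairs_count S t k = pairs_count t S k.
Proof.
rewrite /pairs_count -(card_imset _ (can_inj (g := fun x => (x.2, x.1))
  (f := fun x : 'rV[F]_(t + k - 1) * 'rV[F]_(S + k - 1) => (x.2, x.1)) _)); last by case.
apply: eq_card => -[a b]; rewrite inE /=; apply/no_commonP/imsetP => [H|[[b' a']]].
  by exists (b, a); rewrite ?inE //=; apply/no_commonP => p bp ap; apply: H.
by rewrite inE /= => /no_commonP H [-> ->] p ap bp; apply: H.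
Qed.

Lemma pairs_count_sum S t k :
  pairs_count S t k = (\sum_(b : 'rV[F]_(t + k - 1)) complements S k b)%N.
Proof.
rewrite /pairs_count -sum1_card (partition_big snd predT) //=.
apply: eq_bigr => b _; rewrite /complements -sum1_card.
rewrite (reindex_onto (fun a => (a, b)) fst) /=.
  by apply: eq_bigl => a; rewrite !inE !eqxx !andbT.
by move=> [a b'] /= /andP[_ /eqP ->].
Qed.

Lemma sum_rk L (G : 'rV[F]_L -> nat) B : (L < B)%N ->
  (\sum_b G b = \sum_(0 <= r < B) \sum_(b | rk b == r) G b)%N.
Proof.
move=> LB; have lt (b : 'rV[F]_L) : (rk b < B)%N by have := rk_leL b; lia.
by rewrite big_mkord (partition_big (fun b => Ordinal (lt b)) predT).
Qed.

Lemma card_rk_eq L r :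
  (#|[set b : 'rV[F]_L | rk b == r]| + #|[set b : 'rV[F]_L | rk b < r]%N|
   = #|[set b : 'rV[F]_L | rk b < r.+1]%N|)%N.
Proof.
rewrite -(cardsID [set b : 'rV[F]_L | rk b == r] [set b : 'rV[F]_L | rk b < r.+1]%N).
congr (_ + _)%N; apply: eq_card => b; rewrite !inE ltnS.
  by case: eqP => [->|]; rewrite ?leqnn ?andbF.
by rewrite ltn_neqAle.
Qed.

(** The cumulative counts [4 ^ q] and [2 ^ L] both gain a factor 16. Rank 0 is excluded: one
    functional has rank 0, but twelve have rank 2. *)
Lemma card_rk_shift L L' r : L' = (L + 4)%N ->
  #|[set b : 'rV[F]_L' | rk b == r.+3]| = (16 * #|[set b : 'rV[F]_L | rk b == r.+1]|)%N.
Proof.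
move=> LE.
have cum q : #|[set b : 'rV[F]_L' | rk b < q.+3]%N|
    = (16 * #|[set b : 'rV[F]_L | rk b < q.+1]%N|)%N.
  have [qL|Lq] := leqP (2 * q) L.
    rewrite !card_rk_lt; try lia.
    by rewrite (_ : 2 * q.+2 = 2 * q + 4)%N ?expnD; lia.
  rewrite !card_rk_lt_all; try lia.
  by rewrite LE expnD; lia.
have := card_rk_eq L r.+1; have := card_rk_eq L' r.+3.
by rewrite (cum r) (cum r.+1); lia.
Qed.

(** The differences [k - r] and [r - t] do not change, so only the exponent [S + k - 1] grows, by 2.
    The hypotheses make the truncated subtraction exact. *)
Lemma weight_shift S t k r : (0 < k)%N -> (S <= t.+1)%N -> (2 * r <= t + k)%N ->
  weight S t.+2 k.+2 r.+2 = (4 * weight S t k r)%N.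
Proof.
move=> k0 St rtk; rewrite /weight !subSS mulnA; congr (_ * _)%N.
rewrite -[4%N]/(2 ^ 2)%N -expnD; congr (2 ^ _)%N.
have : (gdim S (k - r) + gdim S (r - t) <= S + k - 1)%N.
  by case E : (k - r)%N => [|c]; case E' : (r - t)%N => [|d] /=; lia.
lia.
Qed.

Lemma pairs_count_shift S t k : (S < k)%N -> (S <= t.+1)%N ->
  pairs_count S t.+2 k.+2 = (64 * pairs_count S t k)%N.
Proof.
move=> Sk St; have k0 : (0 < k)%N by lia.
rewrite !pairs_count_sum (@sum_rk _ _ (t + k + 4)%N.+3); last lia.
rewrite (@sum_rk _ (fun b => complements S k b) (t + k + 4)%N.+1); last lia.
rewrite !big_nat_recl //.
(* By [S < k], rank 0 on the right and ranks 0, 1, 2 on the left contribute nothing; the remaining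
   ranks correspond by a shift of 2. *)
have z L q (i : nat) : (i + S < q)%N ->
    (\sum_(b : 'rV[F]_L | rk b == i) complements S q b = 0)%N.
  by move=> iS; rewrite big1 // => b /eqP bi; apply: complements_eq0; rewrite bi.
rewrite !z ?add0n; try lia.
rewrite big_distrr /=; apply: eq_bigr => i _.
rewrite (eq_bigr (fun=> weight S t.+2 k.+2 i.+3)); last first.
  by move=> b /eqP <-; apply: (@complementsE S t.+2 k.+2); lia.
rewrite [X in (_ = 64 * X)%N](eq_bigr (fun=> weight S t k i.+1)); last first.
  by move=> b /eqP <-; apply: complementsE.
rewrite !sum_nat_const.
have cE L q : #|(fun b : 'rV[F]_L => rk b == q)| = #|[set b : 'rV[F]_L | rk b == q]|.
  by apply: eq_card => b; rewrite inE.
rewrite !cE (@card_rk_shift (t + k - 1)); last lia.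
have [h|h] := leqP (2 * i.+1) (t + k); first by rewrite weight_shift //; lia.
rewrite (_ : #|[set b : 'rV[F]_(t + k - 1) | rk b == i.+1]| = 0%N) ?mul0n ?muln0 //.
apply/eqP; rewrite cards_eq0; apply/eqP/setP => b; rewrite !inE.
by apply/eqP => bi; have := double_rk b; lia.
Qed.

Lemma complements_top S k L (b : 'rV[F]_L) : (k <= rk b)%N ->
  complements S k b = (2 ^ (S + k - 1))%N.
Proof.
move=> kr; rewrite -card_rVF -cardsT; apply: eq_card => a; rewrite !inE.
by apply/no_commonP => p _; apply: rk_min.
Qed.

Lemma complements_base S k (b : 'rV[F]_(S.+1 + k.+1 - 1)) : (k <= S.+1)%N ->
  (2 * complements S k.+1 b + (rk b < k.+1) * 2 ^ k * #|annih_set b k.+1|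
   = 2 ^ (S + k.+1) + ((k == S.+1) && (rk b < 1)) * 2 ^ (S + k.+1))%N.
Proof.
move=> kS; have d := double_rk b.
have [rk_k|kr] := ltnP (rk b) k.+1; last first.
  rewrite complements_top // mul0n addn0.
  rewrite (_ : (rk b < 1)%N = false) ?andbF ?mul0n ?addn0; last lia.
  by rewrite -expnS; congr (2 ^ _)%N; lia.
rewrite mul1n card_annih_small; last lia.
have [r0|r0] := boolP ((k == S.+1) && (rk b < 1)%N).
  rewrite complements_eq0; last lia.
  rewrite -expnD mul1n addnn -mul2n -expnS muln0 add0n; congr (2 ^ _)%N; lia.
rewrite mul0n addn0 complementsE ?weight_one //; try lia.
have := @indep_pairs1 S (k.+1 - rk b).
move: (rk b) d rk_k r0 => r d rk_k r0.
have [c E] : exists c, (k = r + c)%N by exists (k - r)%N; lia.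
rewrite E -addnS addKn /= addn0 => /(_ _)/wrap[]; first lia.
move: (indep_pairs _ _ _ _ _) => X EX.
have -> : (S + (r + c.+1) - 1 - (S + c) = r)%N by lia.
rewrite mulnCA; apply/eqP; rewrite -(eqn_add2r 0).
have -> : (2 ^ (S + (r + c.+1)) = 2 ^ r * (2 * 2 ^ (S + c)))%N.
  by rewrite -expnS -expnD; congr (2 ^ _)%N; lia.
rewrite -EX -expnD; have -> : (2 ^ (r + c + c.+1) = 2 ^ r * (2 * 2 ^ (2 * c)))%N.
  by rewrite -expnS -expnD; congr (2 ^ _)%N; lia.
by rewrite !addn0 -mulnDr -mulnDr.
Qed.

Lemma pairs_count_base S k : (k <= S.+1)%N ->
  (2 * pairs_count S S.+1 k.+1 + 3 * 2 ^ (3 * k)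
   = 2 ^ (2 * S + 2 * k + 2) + 2 ^ (2 * k) + (k == S.+1) * 2 ^ (2 * k))%N.
Proof.
move=> kS; rewrite pairs_count_sum.
pose L := (S.+1 + k.+1 - 1)%N; have LE : L = (S + k.+1)%N by rewrite /L; lia.
pose T := 'rV[F]_L.
have c1 : #|[set b : T | rk b < 1]%N| = 1%N by rewrite (@card_rk_lt L 0).
have ck : #|[set b : T | rk b < k.+1]%N| = (2 ^ (2 * k))%N by rewrite card_rk_lt // LE; lia.
have := @sum_card_annih L k; rewrite -/T => /(_ _)/wrap[]; first lia.
move=> cs.
have sb (P : pred T) : (\sum_(b : T) P b = #|[set b | P b]|)%N.
  by rewrite -sum1dep_card [RHS]big_mkcond /=; apply: eq_bigr => b _; case: (P b).
(* Functionals of rank above [k] have only the zero annihilator and contribute 1 each. *)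
have Q : (\sum_(b : T) (rk b < k.+1) * #|annih_set b k.+1| + 2 ^ L
          = \sum_(b : T) #|annih_set b k.+1| + 2 ^ (2 * k))%N.
  rewrite -ck -sb -card_rVF -sum1_card -!big_split /=; apply: eq_bigr => b _.
  have d := double_rk b.
  rewrite card_annih_small; last by lia.
  case: ltnP => rk_k; first by rewrite mul1n.
  by rewrite (_ : (k.+1 - rk b = 0)%N) //; lia.
have E : (2 * \sum_(b : T) complements S k.+1 b +
          2 ^ k * \sum_(b : T) (rk b < k.+1) * #|annih_set b k.+1|
   = 2 ^ L * 2 ^ (S + k.+1) + (k == S.+1) * 2 ^ (S + k.+1))%N.
  transitivity (\sum_(b : T) (2 * complements S k.+1 b +
      (rk b < k.+1) * 2 ^ k * #|annih_set b k.+1|))%N.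
    rewrite big_split /= !big_distrr /=; congr (_ + _)%N; apply: eq_bigr => b _.
    by rewrite mulnA [(2 ^ k * _)%N]mulnC.
  rewrite (eq_bigr _ (fun b _ => complements_base b kS)) big_split /=.
  rewrite sum_nat_const card_rVF -/L -big_distrl /=; congr (_ + _ * _)%N.
  by case: (k == S.+1) => /=; [rewrite sb c1 | rewrite big1].
have LL : (2 ^ L * 2 ^ (S + k.+1) = 2 ^ (2 * S + 2 * k + 2))%N.
  by rewrite -expnD LE; congr (2 ^ _)%N; lia.
have e1 : ((k == S.+1) * 2 ^ (S + k.+1) = (k == S.+1) * 2 ^ (2 * k))%N.
  by case: eqP => // ->; rewrite !mul1n; congr (2 ^ _)%N; lia.
rewrite LL e1 in E.
(* The coefficient 3 arises as 2 from the first moment plus 1 from the [2 ^ (2 * k)] functionals of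
   rank at most [k]. *)
have Q' : (\sum_(b : T) (rk b < k.+1) * #|annih_set b k.+1| + 2 ^ k = 3 * 2 ^ (2 * k))%N.
  by rewrite expnS in cs; lia.
have p3 : (2 ^ (3 * k) = 2 ^ k * 2 ^ (2 * k))%N by rewrite -expnD; congr (2 ^ _)%N; lia.
have p2 : (2 ^ (2 * k) = 2 ^ k * 2 ^ k)%N by rewrite -expnD; congr (2 ^ _)%N; lia.
rewrite p3 mulnCA -Q' mulnDr -p2 addnA [RHS]addnAC.
exact: (congr1 (addn^~ (2 ^ (2 * k))%N) E).
Qed.

(** Induction on [n]: the shift leads from [(S+1, S+2)] to [(S+1, S)], and symmetry turns this into
    [(S, S+1)]. The base case is [pairs_count_base] at [k = S.+1], where the correction doubles the
    last power. *)
Lemma pairs_count_large n S : (n <= S)%N ->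
  (2 * pairs_count S S.+1 (S + 2 + n) + 3 * 2 ^ (3 * (S + 1 + n))
   = 2 ^ (2 * S + 2 * (S + 1 + n) + 2) + 2 ^ (2 * S + 3 + 4 * n))%N.
Proof.
elim: n S => [|n IHn] S nS.
  rewrite !addn0; have := @pairs_count_base S S.+1 (leqnn _).
  rewrite eqxx mul1n (addn1 S) (addn2 S) => ->.
  rewrite -addnA addnn -mul2n -expnS; congr (_ + 2 ^ _)%N; lia.
case: S nS => // S nS.
rewrite (_ : S.+1 + 2 + n.+1 = (S + 2 + n).+2)%N; last lia.
rewrite pairs_count_shift; [|lia|lia].
rewrite pairs_countC.
have := IHn S nS.
rewrite (_ : 3 * (S.+1 + 1 + n.+1) = 3 * (S + 1 + n) + 6)%N; last lia.
rewrite (_ : 2 * S.+1 + 2 * (S.+1 + 1 + n.+1) + 2 = 2 * S + 2 * (S + 1 + n) + 2 + 6)%N; last lia.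
rewrite (_ : 2 * S.+1 + 3 + 4 * n.+1 = 2 * S + 3 + 4 * n + 6)%N; last lia.
rewrite !(expnD _ _ 6) -[(2 ^ 6)%N]/64%N.
by lia.
Qed.

(** * Hankel matrices *)

Definition hankel n k (a : 'rV[F]_(n + k - 1)) : 'M[F]_(n, k) :=
  \matrix_(i, j) ev a 'X^(i + j).

Lemma hankel_persymmetric n k (a : 'rV[F]_(n + k - 1)) : persymmetric (hankel a).
Proof.
apply/forallP => i1; apply/forallP => j1; apply/forallP => i2; apply/forallP => j2.
by apply/implyP => /eqP E; rewrite !mxE E.
Qed.

(** An empty matrix determines a functional of length [k - 1] only if [k = 1]; this case occurs for
    [s = 0]. *)
Lemma hankel_inj n k : (0 < k)%N -> (0 < n)%N \/ k = 1%N -> injective (@hankel n k).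
Proof.
move=> k0 nk a a' E; apply/rowP => l; have ll := ltn_ord l.
have n0 : (0 < n)%N by lia.
(* The antidiagonal [l] is read at its lowest entry inside the matrix. *)
pose i := minn l n.-1.
have i_n : (i < n)%N by rewrite /i; lia.
have jk : (l - i < k)%N by rewrite /i; lia.
move/matrixP/(_ (Ordinal i_n) (Ordinal jk)): E.
rewrite !mxE /= subnKC; last by rewrite /i; lia.
by rewrite !evXn.
Qed.

Lemma hankel_surj n k (A : 'M[F]_(n, k)) : persymmetric A -> exists a, hankel a = A.
Proof.
move=> /forallP pA.
(* Coefficient [l] is any entry on antidiagonal [l]; persymmetry makes the choice immaterial. *)
exists (\row_l oapp (fun x : 'I_n * 'I_k => A x.1 x.2) 0
         [pick x : 'I_n * 'I_k | (x.1 + x.2 == l)%N]).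
apply/matrixP => i j; have ln : (i + j < n + k - 1)%N.
  by have := ltn_ord i; have := ltn_ord j; lia.
rewrite mxE -[(i + j)%N]/(nat_of_ord (Ordinal ln)) evXn mxE.
case: pickP => [[i' j'] /= /eqP E|/(_ (i, j))]; last by rewrite /= eqxx.
have /forallP/(_ j')/forallP/(_ i)/forallP/(_ j) := pA i'.
by rewrite E eqxx => /eqP.
Qed.

Lemma mul_hankel_eq0 n k (a : 'rV[F]_(n + k - 1)) (v : 'rV[F]_k) : (0 < k)%N ->
  (v *m (hankel a)^T == 0) = annih a k (rVpoly v).
Proof.
move=> k0.
have E j : ev a (rVpoly v * 'X^j) = \sum_i v 0 i * ev a 'X^(j + i).
  rewrite -sum_scale_Xn mulr_suml ev_sum; apply: eq_bigr => i _.
  by rewrite -scalerAl evZ [X in ev a X]mulrC -exprD.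
apply/eqP/annihP => [H|[_ H]].
  split=> [|j jm]; first exact: size_rVpoly.
  have lt : (j < n)%N by lia.
  move/rowP/(_ (Ordinal lt)): H; rewrite !mxE => H0; rewrite E -[RHS]H0.
  by apply: eq_bigr => i _; rewrite !mxE.
apply/rowP => j; rewrite !mxE -[RHS](H j); last by have := ltn_ord j; lia.
by rewrite E; apply: eq_bigr => i _; rewrite !mxE.
Qed.

Lemma rank_hankel n m k (a : 'rV[F]_(n + k - 1)) (b : 'rV[F]_(m + k - 1)) :
  (0 < k)%N -> (\rank (col_mx (hankel a) (hankel b)) == k) = no_common k a b.
Proof.
move=> k0; rewrite -mxrank_tr -[_ == k]/(row_free _) tr_col_mx.
apply/idP/forallP => [fr v|H].
  apply/implyP; rewrite -!mul_hankel_eq0 // => /andP[/eqP av /eqP bv].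
  apply/eqP/(row_free_inj fr); rewrite mul0mx mul_mx_row av bv.
  by rewrite row_mx0.
apply: inj_row_free => v; rewrite mul_mx_row => /eqP; rewrite row_mx_eq0.
by rewrite !mul_hankel_eq0 // => /(implyP (H v))/eqP.
Qed.

Lemma GammaE s t k : (0 < k)%N -> (0 < s)%N \/ k = 1%N -> (0 < t)%N \/ k = 1%N ->
  Gamma s t k k = pairs_count s t k.
Proof.
move=> k0 hs ht; rewrite /Gamma /pairs_count.
pose h (x : 'rV[F]_(s + k - 1) * 'rV[F]_(t + k - 1)) := col_mx (hankel x.1) (hankel x.2).
have hinj : injective h.
  by move=> [a b] [a' b'] /eq_col_mx[/(hankel_inj k0 hs) /= -> /(hankel_inj k0 ht) /= ->].
rewrite -[RHS](card_imset _ hinj); apply: eq_card => M; rewrite inE.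
apply/and3P/imsetP => [[/hankel_surj[a aE] /hankel_surj[b bE] rM]|[[a b]]].
  have ME : M = h (a, b) by rewrite /h /= aE bE vsubmxK.
  by exists (a, b); rewrite // inE -rank_hankel // -[col_mx _ _]/(h (a, b)) -ME.
rewrite inE /= -rank_hankel // => rk_ab ->.
by rewrite /h col_mxKu col_mxKd !hankel_persymmetric.
Qed.

(** All exponents in the theorem are at least -1 in the given ranges, so doubling turns every power
    into a natural number, as in the doubled counts above. *)
Lemma double_exp2z (e : int) (n : nat) : e + 1 = n%:Z -> 2 * (2 : rat) ^ e = (2 ^ n)%:R.
Proof.
by move=> E; rewrite -{1}[2 : rat]expr1z -expfzDr // addrC E natrX.
Qed.

(* Powers of 2 are taken in rat with integer exponents, because 3i - 4 and
   2i - 3 are negative for i = 1.  In the second case the leading exponent is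
   2s + 2i - 1; the source prints 2s + 2i - 2, a misprint (for s = 1, i = 3 the
   printed expression equals -16, while the number of matrices is 48). *)
Theorem theorem2p12 (s i : nat) :
  ((1 <= i <= s + 1)%N ->
     (Gamma s (s + 1) i i)%:R =
       (2 : rat) ^ (2 * s%:Z + 2 * i%:Z - 1)
       - 3 * (2 : rat) ^ (3 * i%:Z - 4)
       + (2 : rat) ^ (2 * i%:Z - 3))
  /\
  ((s + 2 <= i <= 2 * s + 1)%N ->
     (Gamma s (s + 1) i i)%:R =
       (2 : rat) ^ (2 * s%:Z + 2 * i%:Z - 1)
       - 3 * (2 : rat) ^ (3 * i%:Z - 4)
       + (2 : rat) ^ (4 * i%:Z - 2 * s%:Z - 6)).
Proof.
have rat_form (N A B C : nat) (x y z : rat) : (2 * N + 3 * B = A + C)%N ->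
    2 * x = A%:R -> 2 * y = B%:R -> 2 * z = C%:R -> N%:R = x - 3 * y + z.
  move=> /(congr1 (fun n => n%:R : rat)); rewrite /= natrD [in RHS]natrD !natrM => E hA hB hC.
  apply: (@mulfI _ (2 : rat)) => //.
  rewrite mulrDr mulrBr mulrCA hA hB hC; apply/eqP; rewrite addrAC -E.
  by rewrite addrK.
split=> [/andP[i0 is1]|/andP[si i2s]].
  case: i i0 is1 => // k _ ks.
  rewrite GammaE ?addn1; [|lia|lia|lia].
  have := @pairs_count_base s k; rewrite (_ : (k == s.+1) = false); last lia.
  rewrite mul0n addn0 => /(_ _)/wrap[]; first lia.
  by move/rat_form; apply; apply: double_exp2z; lia.
rewrite GammaE ?addn1; [|lia|lia|lia].
have := @pairs_count_large (i - (s + 2)) s.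
rewrite (_ : s + 2 + (i - (s + 2)) = i)%N; last lia.
move=> /(_ _)/wrap[]; first lia.
by move/rat_form; apply; apply: double_exp2z; lia.
Qed.
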